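(* There are non-isomorphic graphs $G$, $H$ such that the system of linear equations $\operatorname{MLIN}(\mathsf P_{\mathrm{iso}}(G,H)^2)$ has a solution over $\mathbb Z$ (i.e. an integer assignment to its variables satisfying all its equations).
   Context: A local isomorphism from $G$ to $H$ is an injective map $\pi$ with domain contained in $V(G)$ and range in $V(H)$ (viewed as a subset of $V(G)\times V(H)$) such that $vv'\in E(G)\iff\pi(v)\pi(v')\in E(H)$ for all $v,v'$ in its domain. Standing assumption: $|V(G)|\ge2$ or $|V(H)|\ge 2$. $\mathsf P_{\mathrm{iso}}(G,H)$ is the set of polynomials (each $p$ standing for $p=0$) in variables $x_{vw}$ ($v\in V(G)$, $w\in V(H)$): $\sum_{v\in V(G)}x_{vw}-1$ for all $w\in V(H)$; $\sum_{w\in V(H)}x_{vw}-1$ for all $v\in V(G)$; $x_{vw}x_{v'w'}$ for all $v,v',w,w'$ such that $\{(v,w),(v',w')\}$ is not a local isomorphism. For a set $\mathsf P$ of polynomials, $\mathsf P^r$ is the set of all polynomials of degree at most $r$ obtained by multiplying a polynomial of $\mathsf P$ by a monomial (including the monomial $1$). $\operatorname{MLIN}(\mathsf P)$ is the system of linear equations obtained by replacing each monomial $x_{i_1}\cdots x_{i_\ell}$ by a new variable $X_{\{i_1,\dots,i_\ell\}}$ (indexed by the set of variables occurring, so e.g. $x_i^2$ becomes $X_{\{i\}}$), constants being kept; each resulting linear polynomial is set equal to $0$. *)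

(* Defs.v *)
From HB Require Import structures.
From mathcomp Require Import all_boot all_order all_algebra.
From mathcomp Require Import mpoly.

Set Implicit Arguments.
Unset Strict Implicit.
Unset Printing Implicit Defensive.

Import GRing.Theory.
Local Open Scope ring_scope.

Record sgraph := SGraph {
  vertex :> finType;
  adj : rel vertex;
  adj_sym : ssrbool.symmetric adj;
  adj_irrefl : irreflexive adj
}.

Definition graph_iso (G H : sgraph) : Prop :=
  exists f : G -> H,
    bijective f /\ forall v v' : G, adj (f v) (f v') = adj v v'.

(* A partial map from G to H is identified with its graph, a set of pairs. *)
Definition local_iso (G H : sgraph) (S : {set G * H}) : Prop :=
  [/\ forall v w w', (v, w) \in S -> (v, w') \in S -> w = w',
      forall v v' w, (v, w) \in S -> (v', w) \in S -> v = v' &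
      forall v v' w w', (v, w) \in S -> (v', w') \in S ->
        adj v v' = adj w w'].

(* Number of variables x_{vw}; the variable x_{vw} is 'X_i with i the rank of
   the pair (v, w) in the enumeration of the finite type G * H. *)
Definition nvar (G H : sgraph) : nat := #|{: G * H}|.

Definition xvar (G H : sgraph) (v : G) (w : H) : {mpoly int[nvar G H]} :=
  'X_(enum_rank (v, w)).

Inductive Piso (G H : sgraph) : {mpoly int[nvar G H]} -> Prop :=
| Piso_col (w : H) : Piso ((\sum_(v : G) xvar v w) - 1)
| Piso_row (v : G) : Piso ((\sum_(w : H) xvar v w) - 1)
| Piso_mul (v v' : G) (w w' : H) :
    ~ local_iso [set (v, w); (v', w')] -> Piso (xvar v w * xvar v' w').

Section MLIN.
Variable n : nat.
Implicit Types (P : {mpoly int[n]} -> Prop) (p q : {mpoly int[n]}).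

(* P^r; msize is the total degree plus one (and 0 for the zero polynomial). *)
Definition pow_sys P (r : nat) q : Prop :=
  exists p (m : 'X_{1..n}),
    [/\ P p, q = p * 'X_[m] & (msize q <= r.+1)%N].

Definition mvars (m : 'X_{1..n}) : {set 'I_n} := [set i | m i != 0%N].

(* The variables X_S, for S a set of the original variables; X_set0 exists as a
   variable but is never produced by mlin, which keeps constants. *)
Definition nXvar : nat := #|{: {set 'I_n}}|.

Definition Xvar (S : {set 'I_n}) : {mpoly int[nXvar]} := 'X_(enum_rank S).

Definition mlin p : {mpoly int[nXvar]} :=
  \sum_(m <- msupp p)
    p@_m *: (if m == 0%MM then 1 else Xvar (mvars m)).

Definition MLIN P (l : {mpoly int[nXvar]}) : Prop :=
  exists2 p, P p & l = mlin p.

End MLIN.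

Definition solution (N : nat) (L : {mpoly int[N]} -> Prop) (a : 'I_N -> int) :
    Prop :=
  forall l, L l -> l.@[a] = 0.

(* Main.v *)
(* In degree 2 a solution amounts to a symmetric integer function Y of pairs
   (v, w), (v', w') that vanishes off the local isomorphisms and whose sums over
   v or over w equal its diagonal value at (v', w'). Let G and H be unions of
   two odd cycles, with equally many vertices. We look for a Y that depends only
   on the cycles through v and w and on the signed displacements from v to v'
   and from w to w' along these cycles. Equality and adjacency can be read off
   the displacements truncated to [-2, 2], so it suffices to put weight only on
   displacements with the same truncation; the freedom left on the non-adjacent
   ones absorbs all but one of the summation conditions. The remaining one is a
   Bezout relation, solvable if the two lengths are coprime in G and in H. Such
   G and H need not be isomorphic: an odd closed walk in a union of odd cycles
   is at least as long as one of these. *)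
Require Import Defs.
From HB Require Import structures.
From mathcomp Require Import all_boot all_order all_algebra.
From mathcomp Require Import ssrcomplements mpoly.
From mathcomp Require Import zify ring.

Set Implicit Arguments.
Unset Strict Implicit.
Unset Printing Implicit Defensive.

Import GRing.Theory Num.Theory.
Local Open Scope ring_scope.

Lemma mvars1 n (i : 'I_n) : mvars U_(i) = [set i].
Proof. by apply/setP=> k; rewrite !inE mnm1E eqb0 negbK eq_sym. Qed.

Lemma mvarsD n (m1 m2 : 'X_{1..n}) : mvars (m1 + m2) = mvars m1 :|: mvars m2.
Proof. by apply/setP=> k; rewrite !inE mnmDE addn_eq0 negb_and. Qed.

Lemma mdeg_le1 n (m : 'X_{1..n}) :
  (mdeg m <= 1)%N -> m = 0%MM \/ exists i, m = U_(i)%MM.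
Proof.
rewrite leq_eqVlt ltnS leqn0 mdeg_eq0 => /orP[/mdeg1P[i /eqP->]|/eqP->].
  by right; exists i.
by left.
Qed.

Lemma msize_sumX_sub1 (K : finType) n (g : K -> 'I_n) (k0 : K) :
  injective g -> (1 < msize ((\sum_k 'X_(g k)) - 1 : {mpoly int[n]}))%N.
Proof.
move=> g_inj; rewrite -(mdeg1 (g k0)); apply: msize_mdeg_lt.
rewrite mcoeff_msupp mcoeffB mcoeff1 mnm1_eq0 subr0 raddf_sum (bigD1 k0) //=.
rewrite mcoeffX eqxx big1 ?addr0 // => k kk0; rewrite mcoeffX; case: eqP => //.
by move=> /(congr1 (@mvars n)); rewrite !mvars1 => /set1_inj/g_inj/eqP/idPn.
Qed.

Section MultilinearEvaluation.
Variable n : nat.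

Lemma mlinE k (p : {mpoly int[n]}) : (msize p <= k)%N ->
  mlin p = \sum_(m : 'X_{1..n < k})
             p@_m *: (if bmnm m == 0%MM then 1 else Xvar (mvars m)).
Proof.
move=> le_pk; rewrite /mlin (big_mksub 'X_{1..n < k}) ?msupp_uniq //=.
  by rewrite big_rmcond //= => m /memN_msupp_eq0->; rewrite scale0r.
by move=> m /msize_mdeg_lt/leq_trans; apply.
Qed.

Fact mlin_is_zmod_morphism : zmod_morphism (@mlin n).
Proof.
move=> p q; pose k := maxn (msize (p - q)) (maxn (msize p) (msize q)).
rewrite !(@mlinE k) ?leq_max ?leqnn ?orbT // -sumrB.
by apply: eq_bigr => m _; rewrite mcoeffB scalerBl.
Qed.

HB.instance Definition _ :=
  GRing.isZmodMorphism.Build {mpoly int[n]} {mpoly int[nXvar n]} (@mlin n)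
    mlin_is_zmod_morphism.

Variable a : {set 'I_n} -> int.

Definition assignment (i : 'I_(nXvar n)) : int := a (enum_val i).

Lemma meval_mlin1 : (mlin 1).@[assignment] = 1.
Proof. by rewrite /mlin msupp1 big_seq1 mcoeff1 eqxx scale1r meval1. Qed.

Lemma meval_mlinX m :
  m != 0%MM -> (mlin 'X_[m]).@[assignment] = a (mvars m).
Proof.
move=> /negPf m_neq0; rewrite /mlin msuppX big_seq1 mcoeffX eqxx scale1r m_neq0.
by rewrite mevalXU /assignment enum_rankK.
Qed.

End MultilinearEvaluation.

Section PairAssignment.
Variables (n : nat) (F : 'I_n -> 'I_n -> int).
Hypothesis F_sym : forall i j, F i j = F j i.

Definition pair_assignment : 'I_(nXvar n) -> int :=
  assignment (fun S =>
    if [pick p : 'I_n * 'I_n | S == [set p.1; p.2]] is Some p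
    then F p.1 p.2 else 0).

Lemma meval_mlinXX i j :
  (mlin 'X_[U_(i) + U_(j)]).@[pair_assignment] = F i j.
Proof.
rewrite meval_mlinX ?mnmD_eq0 ?mnm1_eq0 // mvarsD !mvars1.
case: pickP => [[k l] /= /eqP eq_ijkl|/(_ (i, j))]; last by rewrite eqxx.
have : [/\ i \in [set k; l], j \in [set k; l], k \in [set i; j]
  & l \in [set i; j]] by rewrite -eq_ijkl !set21 !set22 eq_ijkl set21 set22.
rewrite !inE; case; do 4![case/orP=> /eqP ?]; subst=> //; exact: F_sym.
Qed.

Lemma meval_mlinXU i : (mlin 'X_i).@[pair_assignment] = F i i.
Proof.
rewrite -(meval_mlinXX i i) !meval_mlinX ?mnmD_eq0 ?mnm1_eq0 //.
by rewrite mvarsD setUid.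
Qed.

Lemma meval_mlin_sum_sub1 (K : finType) (g : K -> 'I_n) m :
    injective g ->
    \sum_k F (g k) (g k) = 1 ->
    (forall j, \sum_k F (g k) j = F j j) ->
    (msize (((\sum_k 'X_(g k)) - 1) * 'X_[m] : {mpoly int[n]}) <= 3)%N ->
  (mlin (((\sum_k 'X_(g k)) - 1) * 'X_[m])).@[pair_assignment] = 0.
Proof.
move=> g_inj sum1 sumF size3.
have [k0 _|K0] := pickP (mem K); last by rewrite big_pred0 in sum1.
have m_le1 : (mdeg m <= 1)%N.
  have := msize_sumX_sub1 k0 g_inj; move: size3.
  set p := _ - 1 => size_pXm size_p.
  have p_neq0 : p != 0 by rewrite -msize_poly_eq0 -lt0n ltnW.
  have X_neq0 : 'X_[m] != 0 :> {mpoly int[n]} by rewrite -msize_poly_eq0 msizeX.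
  rewrite -(leq_add2l 2); apply: leq_trans size_pXm.
  by rewrite msizeM // msizeX addnS leq_add2r.
rewrite mulrBl mul1r mulr_suml (raddfB (@mlin n)) (raddf_sum (@mlin n)) /=.
rewrite mevalB (raddf_sum (meval _)) /=.
under eq_bigr => k _ do rewrite -mpolyXD.
case: (mdeg_le1 m_le1) => [->|[j ->]].
  rewrite mpolyX0 meval_mlin1 -[X in _ - X]sum1 -sumrB big1 // => k _.
  by rewrite addm0 meval_mlinXU subrr.
rewrite meval_mlinXU -sumF -sumrB big1 // => k _.
by rewrite meval_mlinXX subrr.
Qed.

End PairAssignment.

Record pair_solution (G H : sgraph) (Y : G -> H -> G -> H -> int) : Prop :=
  PairSolution {
    pair_sol_sym : forall v w v' w', Y v w v' w' = Y v' w' v w;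
    pair_sol_supp : forall v w v' w', Y v w v' w' != 0 ->
      (v == v') = (w == w') /\ adj v v' = adj w w';
    pair_sol_col : forall w, \sum_v Y v w v w = 1;
    pair_sol_row : forall v, \sum_w Y v w v w = 1;
    pair_sol_col2 : forall w v' w', \sum_v Y v w v' w' = Y v' w' v' w';
    pair_sol_row2 : forall v v' w', \sum_w Y v w v' w' = Y v' w' v' w'
  }.

Lemma local_iso_pair (G H : sgraph) (v v' : G) (w w' : H) :
  (v == v') = (w == w') -> adj v v' = adj w w' ->
  local_iso [set (v, w); (v', w')].
Proof.
move=> eq_vw adj_vw; split=> [x y y'|x x' y|x x' y y']; rewrite !inE !xpair_eqE.
- do 2![case/orP=> /andP[/eqP ? /eqP ?]]; subst=> //; apply/eqP;
    by [rewrite -eq_vw|rewrite eq_sym -eq_vw].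
- do 2![case/orP=> /andP[/eqP ? /eqP ?]]; subst=> //; apply/eqP;
    by [rewrite eq_vw|rewrite eq_sym eq_vw].
- do 2![case/orP=> /andP[/eqP ? /eqP ?]]; subst=> //;
    by rewrite ?adj_irrefl // adj_sym adj_vw adj_sym.
Qed.

Lemma pair_solution_MLIN (G H : sgraph) (Y : G -> H -> G -> H -> int) :
  pair_solution Y ->
  exists a : 'I_(nXvar (nvar G H)) -> int,
    solution (MLIN (pow_sys (@Piso G H) 2)) a.
Proof.
case=> Y_sym Y_supp col row col2 row2.
pose F (i j : 'I_(nvar G H)) :=
  Y (enum_val i).1 (enum_val i).2 (enum_val j).1 (enum_val j).2.
have F_sym i j : F i j = F j i by exact: Y_sym.
exists (pair_assignment F) => _ [_ [p [m [Pp -> size3]]] ->].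
case: Pp size3 => [w|v|v v' w w' nloc] size3.
- by apply: meval_mlin_sum_sub1 size3 => [//|x y /enum_rank_inj[]||j] //;
    under eq_bigr do rewrite /F enum_rankK /=.
- by apply: meval_mlin_sum_sub1 size3 => [//|x y /enum_rank_inj[]||j] //;
    under eq_bigr do rewrite /F enum_rankK /=.
have -> : m = 0%MM.
  apply/eqP; rewrite -mdeg_eq0 -leqn0; move: size3.
  by rewrite /xvar -!mpolyXD msizeX !mdegD !mdeg1.
rewrite mpolyX0 mulr1 /xvar -mpolyXD meval_mlinXX // /F !enum_rankK.
apply/eqP; apply: contra_notT nloc => /Y_supp[]; exact: local_iso_pair.
Qed.

Lemma intr_Zp_eq0 n (z : int) :
  (1 < n)%N -> (z%:~R == 0 :> 'Z_n) = (n %| z)%Z.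
Proof.
move=> n_gt1; have natE m : (m%:R == 0 :> 'Z_n) = (n %| m)%N.
  by rewrite Zp_nat -val_eqE /= /dvdn Zp_cast.
by case: z => m; rewrite ?NegzE ?dvdzE ?rmorphN ?oppr_eq0 ?natE ?abszN.
Qed.

Section UnionOfCycles.
Variables (I : finType) (n : I -> nat).

(* 'Z_n is the ring of integers modulo n only for n > 1. *)
Definition shift (v : {i : I & 'Z_(n i)}) (z : int) : {i : I & 'Z_(n i)} :=
  Tagged (fun i => 'Z_(n i)) (tagged v + z%:~R).

Definition cycles_adj : rel {i : I & 'Z_(n i)} :=
  fun v w => (w == shift v 1) || (v == shift w 1).

Lemma cycles_adj_sym : ssrbool.symmetric cycles_adj.
Proof. by move=> v w; rewrite /cycles_adj orbC. Qed.

Lemma cycles_adj_irrefl : irreflexive cycles_adj.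
Proof.
case=> i x; rewrite /cycles_adj orbb eq_Tagged /= -subr_eq0 opprD addrA subrr.
by rewrite add0r oppr_eq0 oner_eq0.
Qed.

Definition cycles : sgraph := SGraph cycles_adj_sym cycles_adj_irrefl.

Lemma sum_cycles (F : cycles -> int) :
  \sum_v F v = \sum_i \sum_(x : 'Z_(n i)) F (Tagged (fun i => 'Z_(n i)) x).
Proof.
by rewrite (sig_big_dep xpredT (fun _ => xpredT)); apply: eq_bigr => -[].
Qed.

Lemma sum_tag_cycles (F : I -> int) : (forall i, (1 < n i)%N) ->
  \sum_(v : cycles) F (tag v) = \sum_i (n i)%:Z * F i.
Proof.
move=> n_gt1; rewrite sum_cycles; apply: eq_bigr => i _.
by rewrite /= sumr_const card_ord Zp_cast // pmulrn mulrzz mulrC.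
Qed.

Lemma shift0 v : shift v 0 = v.
Proof. by case: v => i x; rewrite /shift /= addr0. Qed.

Lemma shiftD v z z' : shift v (z + z') = shift (shift v z) z'.
Proof. by rewrite /shift /= rmorphD addrA. Qed.

Lemma shift_fixed v z :
  (1 < n (tag v))%N -> (shift v z == v) = (n (tag v) %| z)%Z.
Proof.
move=> n_gt1; rewrite eq_sym eq_Tagged -subr_eq0 opprD addrA subrr add0r.
by rewrite oppr_eq0 intr_Zp_eq0.
Qed.

Lemma adj_shift (v w : cycles) :
  adj v w -> exists2 e : int, `|e| = 1 & w = shift v e.
Proof.
case/orP=> [/eqP->|/eqP->]; first by exists 1.
by exists (-1); rewrite // -shiftD subrr shift0.
Qed.

Lemma adj_shift1 (v : cycles) : adj v (shift v 1).
Proof. by rewrite /adj /= /cycles_adj eqxx. Qed.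

End UnionOfCycles.

Section CycleHomomorphism.
Variables (I J : finType) (n : I -> nat) (l : J -> nat).

Lemma odd_cycle_hom_leq (f : cycles n -> cycles l) (i : I) :
    odd (n i) -> (1 < n i)%N -> (forall j, (1 < l j)%N) ->
    (forall v w, adj v w -> adj (f v) (f w)) ->
  exists j, (l j <= n i)%N.
Proof.
move=> n_odd n_gt1 l_gt1 f_hom.
pose v0 : cycles n := Tagged (fun i => 'Z_(n i)) (0 : 'Z_(n i)).
have walk (m : nat) : exists2 z : int, f (shift v0 m) = shift (f v0) z &
    (`|z| <= m)%N /\ odd `|z| = odd m.
  elim: m => [|m [z fz [z_le z_odd]]]; first by exists 0; rewrite ?shift0.
  have [|e e1 fe] := @adj_shift _ _ (f (shift v0 m)) (f (shift v0 m.+1)).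
    by apply: f_hom; rewrite -addn1 PoszD shiftD; apply: adj_shift1.
  by exists (z + e); [rewrite fe fz shiftD | lia].
have [z closed [z_le z_odd]] := walk (n i).
have v0_closed : shift v0 (n i) = v0 by apply/eqP; rewrite shift_fixed.
exists (tag (f v0)); apply: leq_trans z_le; apply: dvdn_leq; first by lia.
by move/esym/eqP: closed; rewrite v0_closed shift_fixed.
Qed.

Lemma odd_cycle_not_iso (i : I) :
    odd (n i) -> (1 < n i)%N -> (forall j, (n i < l j)%N) ->
  ~ graph_iso (cycles n) (cycles l).
Proof.
move=> n_odd n_gt1 l_gt [f [_ f_adj]].
have [|v w|j] := odd_cycle_hom_leq (f := f) n_odd n_gt1.
- by move=> j; apply: ltn_trans (l_gt j).
- by rewrite f_adj.
- by rewrite leqNgt l_gt.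
Qed.

End CycleHomomorphism.

Section SignedResidue.
Variable n : nat.
Hypotheses (n_gt1 : (1 < n)%N) (n_odd : odd n).

Definition signed_residue (x : 'Z_n) : int :=
  if (x.*2 < n)%N then x%:Z else x%:Z - n%:Z.

Lemma signed_residue_bound x : (`|signed_residue x|.*2 < n)%N.
Proof.
have := ltn_ord x; rewrite [X in (_ < X)%N -> _]Zp_cast //.
by rewrite /signed_residue; case: ifP; lia.
Qed.

Lemma signed_residueK x : (signed_residue x)%:~R = x.
Proof.
have xK : (x : nat)%:~R = x by rewrite -[RHS]natr_Zp.
rewrite /signed_residue; case: ifP => _ //; rewrite rmorphB /= xK.
by rewrite [_%:~R](pchar_Zp n_gt1) subr0.
Qed.

Lemma intr_signed_residue z : (`|z|.*2 < n)%N -> signed_residue z%:~R = z.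
Proof.
move=> z_lt; have := signed_residue_bound z%:~R.
have : (n %| signed_residue z%:~R - z)%Z.
  by rewrite -intr_Zp_eq0 // rmorphB /= signed_residueK subrr.
move: (signed_residue _) => y; rewrite dvdzE => dvd_n y_lt.
apply/eqP; apply: contraTT dvd_n => neq_yz; rewrite gtnNdvd //; lia.
Qed.

Lemma signed_residueN x : signed_residue (- x) = - signed_residue x.
Proof.
rewrite -{1}[x]signed_residueK -rmorphN /= intr_signed_residue // abszN.
exact: signed_residue_bound.
Qed.

Lemma sum_signed_residue (F : int -> int) :
  \sum_(x : 'Z_n) F (signed_residue x) =
    F 0 + \sum_(1 <= i < n./2.+1) (F i%:Z + F (- i%:Z)).
Proof.
pose f (i : nat) := F (if (i.*2 < n)%N then i%:Z else i%:Z - n%:Z).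
rewrite -(big_mkord predT f) [X in index_iota 0 X]Zp_cast //.
rewrite (big_cat_nat (n := n./2.+1)) /=; try by lia.
rewrite big_ltn // big_split addrA /=; congr (_ + _ + _).
- by rewrite /f ifT //; lia.
- by apply: eq_big_nat => i i_lt; rewrite /f ifT //; lia.
rewrite big_nat_rev -[n./2.+1 in LHS]add1n big_addn.
have -> : (n - n./2 = n./2.+1)%N by lia.
by apply: eq_big_nat => i i_lt; rewrite /f ifF; [congr F|]; lia.
Qed.

End SignedResidue.

Section Displacement.
Variables (I : finType) (n : I -> nat).
Hypotheses (n_gt1 : forall i, (1 < n i)%N) (n_odd : forall i, odd (n i)).
Implicit Types v w : cycles n.

Definition displacement v w : option int :=
  if tag v == tag w then Some (signed_residue (tagged_as v w - tagged v))
  else None.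

Lemma displacement_shift v z :
  (`|z|.*2 < n (tag v))%N -> displacement v (shift v z) = Some z.
Proof.
move=> z_lt; rewrite /displacement /= eqxx tagged_asE /= addrC addKr.
by rewrite intr_signed_residue.
Qed.

Lemma displacementP v w z : displacement v w = Some z -> w = shift v z.
Proof.
case: v w => [i x] [j y]; rewrite /displacement /=.
case: eqP => // eq_ij; case: j / eq_ij y => y; rewrite tagged_asE => -[<-].
by rewrite /shift signed_residueK //= addrC subrK.
Qed.

Lemma eq_displacement v w z :
  (`|z|.*2 < n (tag v))%N -> (displacement v w == Some z) = (w == shift v z).
Proof.
move=> z_lt; apply/eqP/eqP=> [/displacementP//|->].
exact: displacement_shift.
Qed.

Lemma displacementxx v : displacement v v = Some 0.
Proof. by apply/eqP; rewrite eq_displacement ?shift0 //= ltnW. Qed.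

Lemma displacementC v w :
  displacement v w = omap (fun z => - z) (displacement w v).
Proof.
case: v w => [i x] [j y]; rewrite /displacement /= [j == i]eq_sym.
case: eqP => // eq_ij; case: j / eq_ij y => y; rewrite !tagged_asE /=.
by rewrite -opprB signed_residueN.
Qed.

Lemma isSome_displacement v w : isSome (displacement v w) = (tag v == tag w).
Proof. by rewrite /displacement; case: ifP. Qed.

Lemma displacement0E v w : (v == w) = (displacement v w == Some 0).
Proof. by rewrite eq_displacement ?shift0 1?eq_sym //= ltnW. Qed.

Lemma displacement_adjE v w :
  adj v w = (displacement v w \in [:: Some 1; Some (-1)]).
Proof.
have n_gt2 i : (2 < n i)%N.
  by have := n_gt1 i; have := n_odd i; case: (n i) => [|[|[]]].
rewrite !inE !eq_displacement // /adj /= /cycles_adj; congr (_ || _).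
by apply/eqP/eqP=> ->; rewrite -shiftD ?subrr ?addNr shift0.
Qed.

Lemma sum_displacement v (F : option int -> int) :
  \sum_w F (displacement v w) =
    \sum_(x : 'Z_(n (tag v))) F (Some (signed_residue x)) +
    (\sum_(i | i != tag v) n i)%:Z * F None.
Proof.
rewrite sum_cycles (bigD1 (tag v)) //=; congr (_ + _).
  case: v => i x /=; under eq_bigr do rewrite /displacement /= eqxx tagged_asE.
  by rewrite [LHS](reindex_inj (addIr x)); under eq_bigr do rewrite addrK.
rewrite -natz natr_sum mulr_suml; apply: eq_bigr => i i_neq.
under eq_bigr do rewrite /displacement /= eq_sym (negPf i_neq).
by rewrite sumr_const card_ord Zp_cast // mulr_natl.
Qed.

End Displacement.

Definition clamp (s : int) : int := Num.max (-2) (Num.min s 2).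

(* The non-adjacent displacements are those with |s| >= 2. Among them, weight is
   only put on the row and the column of displacement 2, and of displacement -2;
   the corner where these meet is a free parameter. *)
Definition cycle_weight (k corner s t : int) : int :=
  if (clamp s != clamp t) || (2 < `|s|) && (2 < `|t|) then 0
  else if (`|s| == 2) && (`|t| == 2) then corner else k.

Section CycleWeight.
Variables k corner : int.
Implicit Types s t : int.

Lemma clampN s : clamp (- s) = - clamp s.
Proof. by rewrite /clamp; lia. Qed.

Lemma eq_clamp s z : `|z| < 2 -> (clamp s == z) = (s == z).
Proof. by rewrite /clamp => z_lt; apply/eqP/eqP; lia. Qed.

Lemma cycle_weightC s t : cycle_weight k corner s t = cycle_weight k corner t s.
Proof.
by rewrite /cycle_weight eq_sym andbC [X in if X then corner else _]andbC.
Qed.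

Lemma cycle_weightNN s t :
  cycle_weight k corner (- s) (- t) = cycle_weight k corner s t.
Proof. by rewrite /cycle_weight !clampN eqr_opp !normrN. Qed.

Lemma cycle_weight_supp s t :
  cycle_weight k corner s t != 0 -> clamp s = clamp t.
Proof.
by rewrite /cycle_weight; case: (clamp s =P clamp t); rewrite ?eqxx.
Qed.

Lemma cycle_weight0 t : cycle_weight k corner 0 t = if t == 0 then k else 0.
Proof. by case: t => [[|[|[|t]]]|[|[|t]]]. Qed.

Lemma cycle_weight_pm1 t :
  cycle_weight k corner 1 t + cycle_weight k corner (-1) t =
    if `|t| == 1 then k else 0.
Proof. by case: t => [[|[|[|t]]]|[|[|t]]]; rewrite ?addr0 ?add0r. Qed.

Lemma cycle_weight_pm2 t :
  cycle_weight k corner 2 t + cycle_weight k corner (-2) t =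
    if `|t| == 2 then corner else if 2 < `|t| then k else 0.
Proof. by case: t => [[|[|[|t]]]|[|[|t]]]; rewrite ?addr0 ?add0r. Qed.

Lemma cycle_weight_pm_gt2 (i : nat) t : (2 < i)%N ->
  cycle_weight k corner i t + cycle_weight k corner (- i%:Z) t =
    if `|t| == 2 then k else 0.
Proof.
case: i => [|[|[|i]]] // _.
by case: t => [[|[|[|t]]]|[|[|t]]]; rewrite ?addr0 ?add0r.
Qed.

Variable n : nat.
Hypotheses (n_odd : odd n) (n_gt4 : (4 < n)%N).

Lemma sum_cycle_weight t :
  \sum_(x : 'Z_n) cycle_weight k corner (signed_residue x) t =
    if `|t| == 2 then corner + k * ((n./2)%:Z - 2) else k.
Proof.
rewrite (sum_signed_residue _ n_odd (cycle_weight k corner ^~ t)); last by lia.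
have tail : \sum_(3 <= i < n./2.+1)
    (cycle_weight k corner i t + cycle_weight k corner (- i%:Z) t) =
    (if `|t| == 2 then k else 0) * ((n./2)%:Z - 2).
  transitivity (\sum_(3 <= i < n./2.+1) if `|t| == 2 then k else 0).
    by apply: eq_big_nat => i /andP[i_gt2 _]; rewrite cycle_weight_pm_gt2.
  by rewrite sumr_const_nat pmulrn mulrzz; congr (_ * _); lia.
rewrite 2?big_ltn ?tail; [|lia..].
rewrite cycle_weight0 cycle_weight_pm1 cycle_weight_pm2.
by case: t tail => [[|[|[|t]]]|[|[|t]]] _; rewrite /= ?mul0r ?addr0 ?add0r.
Qed.

End CycleWeight.

Lemma sum_signed_residue_eq2 n (k : int) : odd n -> (4 < n)%N ->
  \sum_(x : 'Z_n) (if `|signed_residue x| == 2 then k else 0) = 2 * k.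
Proof.
move=> n_odd n_gt4; pose F := cycle_weight 0 k.
transitivity (\sum_(x : 'Z_n)
    (F (signed_residue x) 2 + F (signed_residue x) (-2))).
  apply: eq_bigr => x _; move: (signed_residue x) => s; rewrite /F.
  by case: s => [[|[|[|s]]]|[|[|s]]]; rewrite ?addr0 ?add0r.
by rewrite big_split !sum_cycle_weight //= !mul0r; ring.
Qed.

Lemma big_bool_neq (F : bool -> nat) b : (\sum_(i | i != b) F i = F (~~ b))%N.
Proof. by rewrite big_mkcond big_bool; case: b; rewrite /= ?addn0. Qed.

Section PairWeight.
Variables (lenG lenH : bool -> nat) (splitG splitH cross : bool -> int).
Hypotheses (lenG_odd : forall c, odd (lenG c))
           (lenG_gt4 : forall c, (4 < lenG c)%N).
Hypotheses (lenH_odd : forall d, odd (lenH d))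
           (lenH_gt4 : forall d, (4 < lenH d)%N).
Hypothesis same_size : (lenG false + lenG true = lenH false + lenH true)%N.

Let lenG_gt1 c : (1 < lenG c)%N. Proof. exact: leq_trans (lenG_gt4 c). Qed.
Let lenH_gt1 d : (1 < lenH d)%N. Proof. exact: leq_trans (lenH_gt4 d). Qed.

Definition mass (c d : bool) : int :=
  2 * splitG c + (lenG (~~ c))%:Z * cross (c (+) d).

Hypothesis massE : forall c d,
  mass c d = 2 * splitH d + (lenH (~~ d))%:Z * cross (c (+) d).
Hypothesis mass_row : forall c, \sum_d (lenH d)%:Z * mass c d = 1.
Hypothesis mass_col : forall d, \sum_c (lenG c)%:Z * mass c d = 1.

Definition corner_weight (c d : bool) : int :=
  mass c d * (3 - ((lenG c)./2)%:Z) - (lenG (~~ c))%:Z * splitH d.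

(* The corner is defined by a summation condition over G; that the condition
   over H gives the same value reflects that G and H have equally many
   vertices. *)
Lemma corner_weightE c d :
  corner_weight c d =
    mass c d * (3 - ((lenH d)./2)%:Z) - (lenH (~~ d))%:Z * splitG c.
Proof.
have half n : odd n -> n%:Z = (n./2)%:Z * 2 + 1 by lia.
have split2G : splitG c * 2 = mass c d - (lenG (~~ c))%:Z * cross (c (+) d).
  by rewrite /mass; ring.
have split2H : splitH d * 2 = mass c d - (lenH (~~ d))%:Z * cross (c (+) d).
  by rewrite massE; ring.
have len_sum : (lenG c)%:Z + (lenG (~~ c))%:Z = (lenH d)%:Z + (lenH (~~ d))%:Z.
  by case: c d {split2G split2H} => [] []; move: same_size => /=; lia.
apply: (@mulIf _ (2 : int)) => //; rewrite /corner_weight !mulrBl -!mulrA.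
rewrite split2G split2H.
have -> : (3 - ((lenG c)./2)%:Z) * 2 = 7 - (lenG c)%:Z.
  by rewrite [in RHS]half //; ring.
have -> : (3 - ((lenH d)./2)%:Z) * 2 = 7 - (lenH d)%:Z.
  by rewrite [in RHS]half //; ring.
have -> : (lenG c)%:Z = (lenH d)%:Z + (lenH (~~ d))%:Z - (lenG (~~ c))%:Z.
  by rewrite -len_sum; ring.
by ring.
Qed.

(* The weight of two pairs of vertices, the first of which lies on the cycles c
   of G and d of H. A displacement is None between two distinct cycles. *)
Definition pair_weight (c d : bool) (s t : option int) : int :=
  match s, t with
  | Some s, Some t => cycle_weight (mass c d) (corner_weight c d) s t
  | Some s, None => if `|s| == 2 then splitG c else 0
  | None, Some t => if `|t| == 2 then splitH d else 0
  | None, None => cross (c (+) d)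
  end.

Lemma sum_pair_weight_col (v : cycles lenG) d t :
  \sum_v' pair_weight (tag v) d (displacement v v') t = mass (tag v) d.
Proof.
rewrite (sum_displacement lenG_gt1 v (pair_weight (tag v) d ^~ t)) big_bool_neq.
case: t => [t|] /=; last by rewrite sum_signed_residue_eq2.
rewrite sum_cycle_weight //; case: ifP => _; last by rewrite mulr0 addr0.
by rewrite /corner_weight; ring.
Qed.

Lemma sum_pair_weight_row c (w : cycles lenH) s :
  \sum_w' pair_weight c (tag w) s (displacement w w') = mass c (tag w).
Proof.
rewrite (sum_displacement lenH_gt1 w (pair_weight c (tag w) s)) big_bool_neq.
case: s => [s|] /=; last by rewrite sum_signed_residue_eq2 // -massE.
under eq_bigr do rewrite cycle_weightC.
rewrite sum_cycle_weight //; case: ifP => _; last by rewrite mulr0 addr0.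
by rewrite corner_weightE; ring.
Qed.

Definition displacement_weight (v : cycles lenG) (w : cycles lenH)
    (v' : cycles lenG) (w' : cycles lenH) : int :=
  pair_weight (tag v) (tag w) (displacement v v') (displacement w w').

Lemma displacement_weightC v w v' w' :
  displacement_weight v w v' w' = displacement_weight v' w' v w.
Proof.
rewrite /displacement_weight (displacementC lenG_gt1 lenG_odd v' v).
rewrite (displacementC lenH_gt1 lenH_odd w' w).
have := isSome_displacement v v'; have := isSome_displacement w w'.
case: (displacement v v') (displacement w w') => [s|] [t|] /=;
  rewrite ?cycle_weightNN ?normrN.
- by move=> /esym/eqP-> /esym/eqP->.
- by move=> _ /esym/eqP->.
- by move=> /esym/eqP->.
by case: (tag v) (tag v') (tag w) (tag w') => [] [] [] [].
Qed.

Lemma displacement_weight_supp v w v' w' :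
  displacement_weight v w v' w' != 0 ->
  (v == v') = (w == w') /\ adj v v' = adj w w'.
Proof.
rewrite /displacement_weight !displacement0E // !displacement_adjE //.
case: (displacement v v') (displacement w w') => [s|] [t|] //=.
- move=> /cycle_weight_supp eq_st; rewrite !inE !(inj_eq Some_inj).
  by rewrite -![s == _]eq_clamp // -![t == _]eq_clamp // eq_st.
- by case: s => [[|[|[|s]]]|[|[|s]]].
- by case: t => [[|[|[|t]]]|[|[|t]]].
Qed.

Lemma displacement_weight_diag v w :
  displacement_weight v w v w = mass (tag v) (tag w).
Proof. by rewrite /displacement_weight !displacementxx. Qed.

Lemma displacement_weight_solution : pair_solution displacement_weight.
Proof.
split=> [v w v' w'|v w v' w'|w|v|w v' w'|v v' w'].
- exact: displacement_weightC.
- exact: displacement_weight_supp.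
- under eq_bigr do rewrite displacement_weight_diag.
  by rewrite (sum_tag_cycles (mass ^~ (tag w))).
- under eq_bigr do rewrite displacement_weight_diag.
  by rewrite (sum_tag_cycles (mass (tag v))).
- under eq_bigr do rewrite displacement_weightC.
  by rewrite sum_pair_weight_col displacement_weight_diag.
- under eq_bigr do rewrite displacement_weightC.
  by rewrite sum_pair_weight_row displacement_weight_diag.
Qed.

End PairWeight.

(* Put k = mass false false and e = cross false - cross true. Equating the two
   expressions for mass determines the other masses from k and e, and turns
   every row and column condition into the same Bezout relation between k and e.
   Since the lengths are odd, cross false = k makes mass - len * cross even, so
   that splitG and splitH are integers. *)
Lemma mass_exists (lenG lenH : bool -> nat) :
    (forall c, odd (lenG c)) -> (forall d, odd (lenH d)) ->
    (lenG false + lenG true = lenH false + lenH true)%N ->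
    coprime (lenG false) (lenG true) -> coprime (lenH false) (lenH true) ->
  exists splitG splitH cross : bool -> int,
    let mass := mass lenG splitG cross in
    [/\ forall c d,
          mass c d = 2 * splitH d + (lenH (~~ d))%:Z * cross (c (+) d),
        forall c, \sum_d (lenH d)%:Z * mass c d = 1 &
        forall d, \sum_c (lenG c)%:Z * mass c d = 1].
Proof.
move=> lenG_odd lenH_odd same_size lenG_coprime lenH_coprime.
have [[k e] /= bezout] : exists ke : int * int,
    (lenG false + lenG true)%N%:Z * ke.1 -
    (lenG true * lenH true)%N%:Z * ke.2 = 1.
  have /coprimezP[[x y] /= xy] :
      coprimez (lenG false + lenG true)%N (lenG true * lenH true)%N.
    rewrite coprimezE /= coprimeMr {2}same_size ![coprime (_ + _) _]coprime_sym.
    by rewrite /coprime !gcdnDr !(gcdnC (_ true)); apply/andP.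
  by exists (x, - y); rewrite -xy /=; ring.
pose halfG c : int := (lenG c)./2; pose halfH d : int := (lenH d)./2.
have lenGE c : (lenG c)%:Z = halfG c * 2 + 1.
  by have := lenG_odd c; rewrite /halfG; lia.
have lenHE d : (lenH d)%:Z = halfH d * 2 + 1.
  by have := lenH_odd d; rewrite /halfH; lia.
have halfHE : halfH false = halfG false + halfG true - halfH true.
  have := lenHE false; have := lenHE true.
  by have := lenGE false; have := lenGE true; lia.
exists (fun c => if c then e * (halfG false - halfH true) - k * halfG false
                 else - k * halfG true).
exists (fun d => if d then e * (halfH false - halfG true) - k * halfH false
                 else - k * halfH true).
exists (fun b => if b then k - e else k).
move: bezout; rewrite PoszD PoszM !lenGE !lenHE => bezout.
split=> [[] []|[]|[]]; rewrite ?big_bool /mass /= ?lenGE ?lenHE ?halfHE.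
1-4: by ring.
1-4: by rewrite -[RHS]bezout; ring.
Qed.

Lemma two_odd_cycles_MLIN (lenG lenH : bool -> nat) :
    (forall c, odd (lenG c)) -> (forall c, 4 < lenG c)%N ->
    (forall d, odd (lenH d)) -> (forall d, 4 < lenH d)%N ->
    (lenG false + lenG true = lenH false + lenH true)%N ->
    coprime (lenG false) (lenG true) -> coprime (lenH false) (lenH true) ->
  exists a : 'I_(nXvar (nvar (cycles lenG) (cycles lenH))) -> int,
    solution (MLIN (pow_sys (@Piso (cycles lenG) (cycles lenH)) 2)) a.
Proof.
move=> lenG_odd lenG_gt4 lenH_odd lenH_gt4 same_size coprimeG coprimeH.
have [splitG [splitH [cross [massE mass_row mass_col]]]] :=
  mass_exists lenG_odd lenH_odd same_size coprimeG coprimeH.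
apply/pair_solution_MLIN/(displacement_weight_solution lenG_odd lenG_gt4
  lenH_odd lenH_gt4 same_size massE mass_row mass_col).
Qed.

Theorem theorem5 :
  exists G H : sgraph,
    [/\ (2 <= #|G|)%N \/ (2 <= #|H|)%N,
        ~ graph_iso G H &
        exists a : 'I_(nXvar (nvar G H)) -> int,
          solution (MLIN (pow_sys (@Piso G H) 2)) a].
Proof.
pose lenG (c : bool) := if c then 11%N else 5%N.
pose lenH (d : bool) := if d then 9%N else 7%N.
exists (cycles lenG), (cycles lenH); split.
- left; apply/card_gt1P.
  pose v : cycles lenG := Tagged (fun c => 'Z_(lenG c)) (0 : 'Z_(lenG false)).
  by exists v, (shift v 1); rewrite // eq_sym shift_fixed.
- by apply: (@odd_cycle_not_iso _ _ lenG lenH false) => // -[].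
- by apply: two_odd_cycles_MLIN => // -[].
Qed.
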